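(* Let $q=p^k$ be an odd prime power with $q\equiv 2\pmod 3$. Let $X$ be a cubic arc-transitive graph of type $\{1,2^1\}$ whose full automorphism group is $G^*=\mathrm{PGL}(2,q)$, such that $G=\mathrm{PSL}(2,q)\le G^*$ is a $1$-arc-regular subgroup of automorphisms. Then the intersection density of $G$ acting on the vertex set of $X$ is \[ \rho(G)=\begin{cases} \tfrac43 & \text{if } q=5^{2k+1} \text{ for some integer } k\ge 0,\\ 1 & \text{if } q\equiv \pm 2 \pmod 5,\\ \tfrac43 & \text{if } q\equiv \pm 1 \pmod 5. \end{cases} \]
   Context: For a transitive permutation group $H\le \mathrm{Sym}(V)$, a subset $\mathcal F\subseteq H$ is intersecting if any two $f,g\in\mathcal F$ satisfy $f(v)=g(v)$ for some $v\in V$; the intersection density is $\rho(H)=\max\{|\mathcal F|:\mathcal F\subseteq H\text{ intersecting}\}/(|H|/|V|)$. An $s$-arc is a sequence $(u_0,\dots,u_s)$ of distinct vertices with consecutive ones adjacent; a group is $s$-arc-regular if it acts regularly on $s$-arcs. A cubic arc-transitive graph $X$ is of type $\{1,2^1\}$ if its full automorphism group acts regularly on $2$-arcs, it has a subgroup acting regularly on arcs, and the edge stabilizer in $\mathrm{Aut}(X)$ is isomorphic to $\mathbb{Z}_2^2$. *)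

(* Defs.v *)
From HB Require Import structures.
From mathcomp Require Import all_boot all_order all_algebra all_fingroup.
From mathcomp Require Import all_solvable.

Set Implicit Arguments.
Unset Strict Implicit.
Unset Printing Implicit Defensive.

Import GRing.Theory.
Local Open Scope group_scope.

(* In SL2, [val u] is the matrix underlying the invertible matrix [u]. *)
Definition SL2 (F : finFieldType) : {set {'GL_2[F]}} :=
  [set u | (\det (val u) == 1)%R].

Fact SL2_group_set (F : finFieldType) : group_set (SL2 F).
Proof.
apply/group_setP; split=> [|u v]; first by rewrite inE /= det1.
by rewrite !inE /= det_mulmx => /eqP-> /eqP->; rewrite mulr1.
Qed.

Canonical SL2_group (F : finFieldType) := Group (SL2_group_set F).

Definition PGL2 (F : finFieldType) : {set coset_of 'Z('GL_2[F])} :=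
  'GL_2[F] / 'Z('GL_2[F]).

Canonical PGL2_group (F : finFieldType) := [group of PGL2 F].

(* PSL(2, F) as a subgroup of PGL(2, F): the image of SL(2, F) under the
   canonical projection. *)
Definition PSL2 (F : finFieldType) : {set coset_of 'Z('GL_2[F])} :=
  SL2 F / 'Z('GL_2[F]).

Canonical PSL2_group (F : finFieldType) := [group of PSL2 F].

Section Density.

Variable V : finType.
Implicit Types (H A : {set {perm V}}).

Definition intersecting A : bool :=
  [forall f in A, forall g in A, exists v, f v == g v].

Definition intersection_density H : rat :=
  ((\max_(A : {set {perm V}} | (A \subset H) && intersecting A) #|A|)%:R
     / (#|H|%:R / #|V|%:R))%R.

End Density.

Definition acts_regularly (gT : finGroupType) (T : finType)
    (A : {set gT}) (S : {set T}) (to : {action gT &-> T}) : bool :=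
  [transitive A, on S | to] && [forall x in S, 'C_A[x | to] == 1].

Section Graph.

(* A finite simple graph is a finite vertex type V with a symmetric and
   irreflexive adjacency relation. *)
Variables (V : finType) (adj : rel V).

Definition simple_graph : Prop := symmetric adj /\ irreflexive adj.

Definition cubic : bool := [forall v, #|[set w | adj v w]| == 3].

Definition graph_aut : {set {perm V}} :=
  [set s : {perm V} | [forall x, forall y, adj (s x) (s y) == adj x y]].

Fact graph_aut_group_set : group_set graph_aut.
Proof.
apply/group_setP; split=> [|s t].
  by rewrite inE; apply/forallP=> x; apply/forallP=> y; rewrite !perm1.
rewrite !inE => /forallP sP /forallP tP.
apply/forallP=> x; apply/forallP=> y; rewrite !permM.
by rewrite (eqP (forallP (tP _) _)) (forallP (sP _) _).
Qed.

Canonical graph_aut_group := Group graph_aut_group_set.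

Definition arcs (s : nat) : {set s.+1.-tuple V} :=
  [set t : s.+1.-tuple V | uniq t & sorted adj t].

Definition arc_regular (s : nat) (H : {set {perm V}}) : bool :=
  acts_regularly H (arcs s) ('P * s.+1).

Definition arc_transitive : bool :=
  [transitive graph_aut, on arcs 1 | 'P * 2].

Definition type_1_21 : Prop :=
  [/\ arc_regular 2 graph_aut,
      exists2 H : {group {perm V}}, H \subset graph_aut & arc_regular 1 H
    & forall u v, adj u v ->
        'N_graph_aut([set u; v] | 'P) \isog [set: 'Z_2 * 'Z_2]].

End Graph.

(* Main.v *)
Require Import Defs.
From mathcomp Require Import all_boot all_order all_algebra all_fingroup.
From mathcomp Require Import all_solvable all_field ring zify.

(* Vertex stabilisers in G have order 3, and all subgroups of order 3 of
   PSL(2, q) are conjugate in PGL(2, q), so f and g agree at a vertex iff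
   f g^-1 has order 1 or 3.  For distinct lifts M, N in SL(2, q) this says
   tr (M N^-1) = 1 or -1, where tr (M N^-1) is the polar form of the quadratic
   form det on the 2 x 2 matrices.  An intersecting set is thus a set of
   vectors with Gram matrix 2 on the diagonal and +-1 elsewhere in a
   4-dimensional quadratic space of square discriminant.  Up to changing signs
   of vectors, the Gram determinant of four of them is 5, -3 or -27; as
   q = 2 mod 3 makes -3 a nonsquare, it is 5, which must be a square, and all
   the inner products can be taken to be 1.  Five vectors would have Gram
   determinant 6 <> 0 in dimension 4.  Conversely a square root of 5 gives
   four vectors inside the icosian quaternions, and 5 is a square in F_q iff
   q = 0, 1 or 4 mod 5. *)

Set Implicit Arguments.
Unset Strict Implicit.
Unset Printing Implicit Defensive.

Import GRing.Theory.

(** * Squares in a finite field *)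

Section FiniteFieldFacts.

Local Open Scope ring_scope.

Variable F : finFieldType.
Implicit Types x y r s t u v w : F.

Lemma card_finField_natr : #|F|%:R = 0 :> F.
Proof.
have := @expg_cardG F [set: F]%G (1%R : F) (in_setT _).
by rewrite FinRing.zmodXgE cardsT.
Qed.

Lemma finField_two_neq0 : odd #|F| -> 2 != 0 :> F.
Proof.
move=> oddF; apply/eqP=> two0; move: card_finField_natr.
rewrite -(odd_double_half #|F|) oddF.
by rewrite natrD -muln2 natrM two0 mulr0 addr0 => /eqP; rewrite oner_eq0.
Qed.

Lemma finField_three_neq0 : #|F| = 2 %[mod 3] -> 2 != 0 :> F -> 3 != 0 :> F.
Proof.
move=> F3; apply: contraNneq => three0; move: card_finField_natr.
by rewrite (divn_eq #|F| 3) F3 natrD natrM three0 mulr0 add0r => ->.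
Qed.

(** A square root of -3 yields a root [w] of X^2 + X + 1, so [w ^+ 3 = 1]. As the field has order q
    = 2 mod 3, [w ^+ q = w] becomes [w ^+ 2 = w]; hence [w = 1] and 3 = 0. *)
Lemma minus3_nonsquare s : odd #|F| -> #|F| = 2 %[mod 3] -> s ^+ 2 != - 3.
Proof.
move=> oddF F3; have F2 := finField_two_neq0 oddF.
have three := finField_three_neq0 F3 F2.
apply/eqP=> s2; pose w := (s - 1) / 2.
have w2: w ^+ 2 + w + 1 = 0.
  have w_def : 2 * w = s - 1 by rewrite mulrC divfK.
  apply: (mulfI F2); apply: (mulfI F2); rewrite !mulr0.
  transitivity ((2 * w) ^+ 2 + 2 * (2 * w) + 4); first by ring.
  by rewrite w_def; transitivity (s ^+ 2 + 3); [ring | rewrite s2 addNr].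
have w3 : w ^+ 3 = 1.
  apply/eqP; rewrite -subr_eq0; apply/eqP.
  by transitivity ((w - 1) * (w ^+ 2 + w + 1)); [ring | rewrite w2 mulr0].
have := expf_card w; rewrite (divn_eq #|F| 3) F3 exprD mulnC exprM w3 expr1n mul1r.
move=> w2w; have w1: w = 1.
  by rewrite -w3 exprSr -[w ^+ 2]/(w ^+ (2 %% 3)) w2w -expr2 w2w.
by move: w2; rewrite w1 => /eqP; apply/negP; rewrite (_ : _ + _ = 3) //; ring.
Qed.

(** Pigeonhole: the squares [S] and their reflection [T] each contain more than half of the field,
    so they meet. *)
Lemma minus1_sum_two_squares : odd #|F| -> exists x y, x ^+ 2 + y ^+ 2 = - 1.
Proof.
move=> oddF; pose S := [set x ^+ 2 | x : F]; pose T := [set - 1 - x | x in S].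
have cardS : (#|F| < #|S| + #|S|)%N.
  have leF : (#|F| <= #|S| + #|S|)%N.
    (* [g] chooses a square root, so the images of [S] under [g] and [- g] cover the field; the
       default 0 is never reached on [S]. Oddness of [#|F|] later makes the inequality strict. *)
    pose g s := odflt 0 [pick x : F | x ^+ 2 == s].
    apply: leq_trans (leq_add (leq_imset_card g (mem S))
      (leq_imset_card (fun s => - g s) (mem S))).
    apply: leq_trans (leq_card_setU _ _); rewrite -[leqLHS]cardsT.
    apply/subset_leq_card/subsetP=> x _.
    have : (g (x ^+ 2)) ^+ 2 = x ^+ 2.
      by rewrite /g; case: pickP => [y /eqP // | /(_ x)]; rewrite eqxx.
    have Sx : x ^+ 2 \in S by apply: imset_f.
    move/eqP; rewrite eqf_sqr => /orP[] /eqP gx; rewrite inE; apply/orP; [left|right].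
      by apply/imsetP; exists (x ^+ 2).
    by apply/imsetP; exists (x ^+ 2); rewrite // gx opprK.
  rewrite ltn_neqAle leF andbT; apply: contraTneq oddF => ->.
  by rewrite addnn odd_double.
have cardT : #|T| = #|S| by rewrite card_in_imset // => x y _ _ /addrI/oppr_inj.
have : ~~ [disjoint S & T].
  rewrite disjoint_subset; apply: contraL cardS => /subset_leq_card ST.
  rewrite -leqNgt -{2}cardT -(cardC (mem T)) addnC leq_add2l.
  exact: leq_trans ST _.
case/pred0Pn=> _ /andP[/imsetP[x _ ->] /imsetP[_ /imsetP[y _ ->]]] xy.
by exists x, y; rewrite xy subrK.
Qed.

End FiniteFieldFacts.

(** * Two-by-two matrices and the polar form of the determinant *)

Section TwoByTwo.

Local Open Scope ring_scope.

Variable R : comNzRingType.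
Implicit Types (a b c d : R) (M N : 'M[R]_2).

Definition mx2 a b c d : 'M[R]_2 :=
  \matrix_(i, j) if i == 0 then if j == 0 then a else b
                 else if j == 0 then c else d.

Lemma mx2_eta M : M = mx2 (M 0 0) (M 0 1) (M 1 0) (M 1 1).
Proof.
apply/matrixP=> i j; rewrite mxE.
by case: i => [[|[|i]] //= ?]; case: j => [[|[|j]] //= ?];
   rewrite /eq_op /=; congr (M _ _); apply: val_inj.
Qed.

Variant mx2_spec : 'M[R]_2 -> Type := Mx2Spec a b c d : mx2_spec (mx2 a b c d).

Lemma mx2P M : mx2_spec M.
Proof. by rewrite (mx2_eta M). Qed.

Lemma mx2_inj a b c d a' b' c' d' :
  mx2 a b c d = mx2 a' b' c' d' -> [/\ a = a', b = b', c = c' & d = d'].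
Proof.
by move/matrixP=> e; split; [have := e 0 0 | have := e 0 1 | have := e 1 0 | have := e 1 1];
   rewrite !mxE.
Qed.

Lemma mulmx2 a b c d a' b' c' d' :
  mx2 a b c d *m mx2 a' b' c' d' =
  mx2 (a * a' + b * c') (a * b' + b * d') (c * a' + d * c') (c * b' + d * d').
Proof.
rewrite [LHS]mx2_eta; congr mx2; by rewrite !mxE !big_ord_recl big_ord0 /= !mxE /= addr0.
Qed.

Lemma det_mx2 a b c d : \det (mx2 a b c d) = a * d - b * c.
Proof.
rewrite (expand_det_row _ 0) !big_ord_recl big_ord0 /cofactor !det_mx11 !mxE /=.
by rewrite expr0 expr1; ring.
Qed.

Lemma tr_mx2 a b c d : \tr (mx2 a b c d) = a + d.
Proof. by rewrite /mxtrace !big_ord_recl big_ord0 !mxE /= addr0. Qed.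

Lemma scalar_mx2 a : a%:M = mx2 a 0 0 a.
Proof. by rewrite [LHS]mx2_eta !mxE /= mulr1n. Qed.

Lemma opp_mx2 a b c d : - mx2 a b c d = mx2 (- a) (- b) (- c) (- d).
Proof. by rewrite [LHS]mx2_eta !mxE. Qed.

(** The adjugate formula is the polarisation det (M + N) - det M - det N, and it is tr (M N^-1) as
    soon as det N = 1. *)
Definition polar_det M N : R := \tr (M *m \adj N).

Lemma adj_mx2 a b c d : \adj (mx2 a b c d) = mx2 d (- b) (- c) a.
Proof.
rewrite [LHS]mx2_eta !mxE /cofactor !det_mx11 !mxE /=.
by congr mx2; rewrite ?expr0 ?expr1 ?mulr1 ?mul1r ?mulN1r // sqrrN expr1n mul1r.
Qed.

Lemma polar_det_mx2 a b c d a' b' c' d' :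
  polar_det (mx2 a b c d) (mx2 a' b' c' d') = a * d' + a' * d - b * c' - b' * c.
Proof. by rewrite /polar_det adj_mx2 mulmx2 tr_mx2; ring. Qed.

Lemma polar_det1 M : polar_det M 1%:M = \tr M.
Proof. by case: M / mx2P => a b c d; rewrite scalar_mx2 polar_det_mx2 tr_mx2; ring. Qed.

Lemma polar_det_mulr M N P :
  polar_det (M *m P) (N *m P) = \det P * polar_det M N.
Proof.
case: M / mx2P => a b c d; case: N / mx2P => a' b' c' d'; case: P / mx2P => x y z t.
by rewrite !mulmx2 !polar_det_mx2 det_mx2; ring.
Qed.

Lemma polar_detC M N : polar_det M N = polar_det N M.
Proof.
by case: M / mx2P => a b c d; case: N / mx2P => a' b' c' d'; rewrite !polar_det_mx2; ring.
Qed.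

(** Cayley-Hamilton applied twice. The coefficient of [M] vanishes when tr^2 = det, which is how
    order 3 in the projective group is read off the trace. *)
Lemma cube_mx2 M : M *m M *m M = (\tr M ^+ 2 - \det M) *: M - (\tr M * \det M)%:M.
Proof.
case: M / mx2P => a b c d; rewrite !mulmx2 tr_mx2 det_mx2.
by rewrite [RHS]mx2_eta !mxE /=; congr mx2; ring.
Qed.

End TwoByTwo.

(** * Gram determinants and cliques of the polar form *)

Section PolarGram.

Local Open Scope ring_scope.

(* The volume form on the traceless parts of three matrices. *)
Definition triple_form (R : comNzRingType) (M N P : 'M[R]_2) : R :=
  \tr (M *m N *m P) - \tr (M *m P *m N).

(** This is -2 times the polar form of det on the traceless parts, scaled so that nothing has to be
    halved. *)
Definition traceless_form (R : comNzRingType) (M N : 'M[R]_2) : R :=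
  \tr M * \tr N - 2 * polar_det M N.

(** Traceless matrices form a 3-dimensional space, so a 3 by 3 Gram determinant is a constant times
    the product of two volumes. Allowing two different triples makes it possible to compare their
    volumes. *)
Lemma traceless_gram (R : comNzRingType) (M1 M2 M3 N1 N2 N3 : 'M[R]_2) :
  let g := @traceless_form R in
  g M1 N1 * (g M2 N2 * g M3 N3 - g M2 N3 * g M3 N2)
  - g M1 N2 * (g M2 N1 * g M3 N3 - g M2 N3 * g M3 N1)
  + g M1 N3 * (g M2 N1 * g M3 N2 - g M2 N2 * g M3 N1)
  = - 4 * (triple_form M1 M2 M3 * triple_form N1 N2 N3).
Proof.
move=> g; rewrite {}/g /traceless_form /triple_form.
case: M1 / mx2P => a1 b1 c1 d1; case: M2 / mx2P => a2 b2 c2 d2.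
case: M3 / mx2P => a3 b3 c3 d3.
case: N1 / mx2P => e1 f1 g1 h1; case: N2 / mx2P => e2 f2 g2 h2.
case: N3 / mx2P => e3 f3 g3 h3.
rewrite !mulmx2 !polar_det_mx2 !tr_mx2.
by ring.
Qed.

Lemma polar_det_diag (R : comNzRingType) (M : 'M[R]_2) : polar_det M M = 2 * \det M.
Proof. by case: M / mx2P => a b c d; rewrite polar_det_mx2 det_mx2; ring. Qed.

Lemma det_adj_mx2 (R : comNzRingType) (M : 'M[R]_2) : \det (\adj M) = \det M.
Proof. by case: M / mx2P => a b c d; rewrite adj_mx2 !det_mx2; ring. Qed.

Lemma traceless_form1 (R : comNzRingType) (M N : 'M[R]_2) :
  \tr M = 1 -> \tr N = 1 -> traceless_form M N = 1 - 2 * polar_det M N.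
Proof. by rewrite /traceless_form => -> ->; rewrite mulr1. Qed.

Lemma polar_detZ (R : comNzRingType) a (M N : 'M[R]_2) :
  polar_det (a *: M) N = a * polar_det M N.
Proof. by rewrite /polar_det -scalemxAl linearZ. Qed.

Variable F : fieldType.
Implicit Types M N : 'M[F]_2.
Hypotheses (F2 : 2 != 0 :> F) (F3 : 3 != 0 :> F).
Hypothesis m3_nonsquare : forall s : F, s ^+ 2 != - 3.

(* The Gram determinant of the traceless parts is [-20] when all three values
   are [1]; every other sign pattern makes it [-4 t^2] with [t^2 = -3] or
   [t^2 = -27]. *)
Lemma polar_det_triple M1 M2 M3 :
    \det M1 = 1 -> \det M2 = 1 -> \det M3 = 1 ->
    \tr M1 = 1 -> \tr M2 = 1 -> \tr M3 = 1 ->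
    polar_det M1 M2 ^+ 2 = 1 -> polar_det M1 M3 ^+ 2 = 1 ->
    polar_det M2 M3 ^+ 2 = 1 ->
  [/\ polar_det M1 M2 = 1, polar_det M1 M3 = 1, polar_det M2 M3 = 1
    & triple_form M1 M2 M3 ^+ 2 = 5].
Proof.
move=> d1 d2 d3 t1 t2 t3 e12 e13 e23.
have := traceless_gram M1 M2 M3 M1 M2 M3; rewrite /= !traceless_form1 //.
rewrite !polar_det_diag d1 d2 d3 (polar_detC M2 M1) (polar_detC M3 M1) (polar_detC M3 M2).
set t := triple_form _ _ _.
have F4 : - 4 != 0 :> F by rewrite oppr_eq0 (_ : 4 = 2 * 2) ?mulf_neq0 //; ring.
have no3 : - 4 * (t * t) = - 4 * - 3 -> False.
  by move/(mulfI F4)/eqP; rewrite -expr2; apply/negP/m3_nonsquare.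
have no27 : - 4 * (t * t) = - 4 * - 27 -> False.
  move/(mulfI F4) => tt; have /eqP := m3_nonsquare (t / 3); apply.
  by rewrite expr_div_n expr2 tt; field; rewrite (_ : 9 = 3 * 3) ?mulf_neq0 //; ring.
have : polar_det M1 M2 = 1 \/ polar_det M1 M2 = -1.
  by move/eqP: e12; rewrite sqrf_eq1 => /orP[] /eqP; [left | right].
have : polar_det M1 M3 = 1 \/ polar_det M1 M3 = -1.
  by move/eqP: e13; rewrite sqrf_eq1 => /orP[] /eqP; [left | right].
have : polar_det M2 M3 = 1 \/ polar_det M2 M3 = -1.
  by move/eqP: e23; rewrite sqrf_eq1 => /orP[] /eqP; [left | right].
case=> ->; case=> ->; case=> -> => g.
- by split=> //; apply: (mulfI F4); rewrite expr2 -g; ring.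
all: exfalso; by first [apply: no3; rewrite -g; ring | apply: no27; rewrite -g; ring].
Qed.

(** The triples (M1, M2, M3) and (M1, M2, M4) have volumes whose squares are both 5, so the product
    of the volumes is 5 or -5. Their mixed Gram determinant is -4, which makes that product 1; so 16
    = 0 or 24 = 0. *)
Lemma polar_det_quadruple M1 M2 M3 M4 :
    \det M1 = 1 -> \det M2 = 1 -> \det M3 = 1 -> \det M4 = 1 ->
    \tr M1 = 1 -> \tr M2 = 1 -> \tr M3 = 1 -> \tr M4 = 1 ->
    polar_det M1 M2 ^+ 2 = 1 -> polar_det M1 M3 ^+ 2 = 1 ->
    polar_det M1 M4 ^+ 2 = 1 -> polar_det M2 M3 ^+ 2 = 1 ->
    polar_det M2 M4 ^+ 2 = 1 -> polar_det M3 M4 ^+ 2 = 1 ->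
  False.
Proof.
move=> d1 d2 d3 d4 t1 t2 t3 t4 e12 e13 e14 e23 e24 e34.
have [p12 p13 p23 sq5] := polar_det_triple d1 d2 d3 t1 t2 t3 e12 e13 e23.
have [_ p14 p24 sq5'] := polar_det_triple d1 d2 d4 t1 t2 t4 e12 e14 e24.
have [_ _ p34 _] := polar_det_triple d2 d3 d4 t2 t3 t4 e23 e24 e34.
have := traceless_gram M1 M2 M3 M1 M2 M4; rewrite /= !traceless_form1 //.
rewrite !polar_det_diag d1 d2 (polar_detC M2 M1) (polar_detC M3 M1) (polar_detC M3 M2).
rewrite p12 p13 p14 p23 p24 p34.
have /eqP := etrans sq5 (esym sq5'); rewrite eqf_sqr => /orP[] /eqP ->.
  rewrite -(expr2 (triple_form _ _ _)) sq5' => /eqP; rewrite -subr_eq0; apply/negP.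
  rewrite (_ : _ - _ = 2 * 2 * 2 * 2); last by ring.
  by rewrite !mulf_neq0.
rewrite (mulNr (triple_form _ _ _)) -(expr2 (triple_form _ _ _)) sq5' => /eqP.
rewrite -subr_eq0; apply/negP.
rewrite (_ : _ - _ = - (2 * 2 * 2 * 3)); last by ring.
by rewrite oppr_eq0 !mulf_neq0.
Qed.

(** Right division by [M0] moves [M0] to the identity, and the sign [polar_det M M0] turns the trace
    into 1. This reduces a clique containing [M0] to one of trace 1 matrices with one member
    fewer. *)
Let normalise M0 M := polar_det M M0 *: (M *m \adj M0).

Let tr_normalise M0 M : polar_det M M0 ^+ 2 = 1 -> \tr (normalise M0 M) = 1.
Proof. by rewrite linearZ /= -/(polar_det M M0) -expr2. Qed.

Let det_normalise M0 M :
  \det M0 = 1 -> \det M = 1 -> polar_det M M0 ^+ 2 = 1 -> \det (normalise M0 M) = 1.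
Proof. by move=> d0 d e; rewrite detZ e det_mulmx det_adj_mx2 d d0 !mulr1. Qed.

Let polar_normalise M0 M N : \det M0 = 1 -> polar_det M M0 ^+ 2 = 1 ->
    polar_det N M0 ^+ 2 = 1 -> polar_det M N ^+ 2 = 1 ->
  polar_det (normalise M0 M) (normalise M0 N) ^+ 2 = 1.
Proof.
move=> d0 eM eN eMN.
rewrite /normalise polar_detZ (polar_detC (M *m _)) polar_detZ.
rewrite polar_det_mulr det_adj_mx2 d0 mul1r.
by rewrite !exprMn eM eN (polar_detC N) eMN !mul1r.
Qed.

Lemma five_square_of_clique4 M0 M1 M2 M3 :
    \det M0 = 1 -> \det M1 = 1 -> \det M2 = 1 -> \det M3 = 1 ->
    polar_det M1 M0 ^+ 2 = 1 -> polar_det M2 M0 ^+ 2 = 1 ->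
    polar_det M3 M0 ^+ 2 = 1 -> polar_det M1 M2 ^+ 2 = 1 ->
    polar_det M1 M3 ^+ 2 = 1 -> polar_det M2 M3 ^+ 2 = 1 ->
  exists r : F, r ^+ 2 = 5.
Proof.
move=> d0 d1 d2 d3 e1 e2 e3 e12 e13 e23.
have [] := @polar_det_triple (normalise M0 M1) (normalise M0 M2) (normalise M0 M3);
  try by [exact: det_normalise | exact: tr_normalise | exact: polar_normalise].
move=> _ _ _ r5.
by exists (triple_form (normalise M0 M1) (normalise M0 M2) (normalise M0 M3)).
Qed.

Lemma no_clique5 M0 M1 M2 M3 M4 :
    \det M0 = 1 -> \det M1 = 1 -> \det M2 = 1 -> \det M3 = 1 -> \det M4 = 1 ->
    polar_det M1 M0 ^+ 2 = 1 -> polar_det M2 M0 ^+ 2 = 1 ->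
    polar_det M3 M0 ^+ 2 = 1 -> polar_det M4 M0 ^+ 2 = 1 ->
    polar_det M1 M2 ^+ 2 = 1 -> polar_det M1 M3 ^+ 2 = 1 ->
    polar_det M1 M4 ^+ 2 = 1 -> polar_det M2 M3 ^+ 2 = 1 ->
    polar_det M2 M4 ^+ 2 = 1 -> polar_det M3 M4 ^+ 2 = 1 ->
  False.
Proof.
move=> d0 d1 d2 d3 d4 e1 e2 e3 e4 e12 e13 e14 e23 e24 e34.
by apply: (@polar_det_quadruple (normalise M0 M1) (normalise M0 M2)
  (normalise M0 M3) (normalise M0 M4)); 
  by [exact: det_normalise | exact: tr_normalise | exact: polar_normalise].
Qed.

End PolarGram.

(** * PGL(2, q), PSL(2, q) and their elements of order 3 *)

Section ProjectiveGroups.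

Local Open Scope group_scope.

Variable F : finFieldType.
Implicit Types (u w g : {'GL_2[F]}) (x y : coset_of 'Z('GL_2[F])).

Local Notation Z := 'Z('GL_2[F]).

Lemma val_GL2M u w : (val (u * w)%g = val u *m val w)%R.
Proof. by []. Qed.

Lemma GL2_of_det (M : 'M[F]_2) : (\det M != 0)%R -> {u : {'GL_2[F]} | val u = M}.
Proof.
rewrite -unitfE -unitmxE => uM.
by exists (FinRing.Unit (uM : (M : 'M[F]_2.-1.+1) \is a GRing.unit)).
Qed.

(** A matrix commuting with the two elementary transvections [e] and [f] is already scalar. *)
Lemma center_GL2P u : reflect (exists a : F, val u = a%:M)%R (u \in Z).
Proof.
apply: (iffP idP) => [/centerP[_ cu] | [a ua]]; last first.
  apply/centerP; split=> [|w _]; first exact: in_setT.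
  by apply: val_inj; rewrite [LHS]val_GL2M [RHS]val_GL2M ua scalar_mxC.
have [e eE] : {e : {'GL_2[F]} | val e = mx2 1 1 0 1}%R.
  by apply: GL2_of_det; rewrite det_mx2 mul1r mulr0 subr0 oner_neq0.
have [f fE] : {f : {'GL_2[F]} | val f = mx2 1 0 1 1}%R.
  by apply: GL2_of_det; rewrite det_mx2 mul1r mul0r subr0 oner_neq0.
have := congr1 val (cu e (in_setT _)); have := congr1 val (cu f (in_setT _)).
rewrite !val_GL2M eE fE; case: (val u) / mx2P => a b c d.
rewrite !mulmx2 => /mx2_inj[e1 _ _ _] /mx2_inj[_ e3 _ e4].
move: e1 e3 e4; rewrite !(mulr1, mul1r, mul0r, addr0, add0r).
rewrite -[X in _ = X -> _]addr0 => /addrI->; rewrite add0r addr0 => <-.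
rewrite -[X in _ = X -> _]add0r => /addIr->.
by exists a; rewrite scalar_mx2.
Qed.

Lemma GL2_normZ u : u \in 'N(Z).
Proof. exact: subsetP (normal_norm (center_normal _)) u (in_setT u). Qed.

Lemma val_inv_SL2 u : u \in SL2 F -> val (u^-1)%g = (\adj (val u))%R.
Proof.
rewrite inE => /eqP du; rewrite [LHS]/(invmx (val u)) /invmx GL_unitmx.
by rewrite du invr1 scale1r.
Qed.

Lemma tr_quotient_SL2 u w :
  w \in SL2 F -> (\tr (val (u * w^-1)%g) = polar_det (val u) (val w))%R.
Proof. by move=> SLw; rewrite val_GL2M val_inv_SL2. Qed.

Lemma val_cube u : (val (u ^+ 3)%g = val u *m val u *m val u)%R.
Proof. by rewrite !expgS mulg1 !val_GL2M mulmxA. Qed.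

Lemma coset_cube1_tr u :
  u \in SL2 F -> (\tr (val u) ^+ 2 = 1)%R -> coset Z u ^+ 3 = 1.
Proof.
rewrite inE => /eqP du tu; rewrite -morphX ?GL2_normZ //; apply/coset_id/center_GL2P.
exists (- (\tr (val u) * \det (val u)))%R.
by rewrite val_cube cube_mx2 tu du subrr scale0r sub0r raddfN.
Qed.

(** If tr^2 differed from 1, Cayley-Hamilton could be solved for [u] in terms of its scalar cube,
    making [u] scalar. *)
Lemma tr_coset_cube1 u : u \in SL2 F ->
  coset Z u ^+ 3 = 1 -> coset Z u != 1 -> (\tr (val u) ^+ 2 = 1)%R.
Proof.
rewrite inE => /eqP du u3 u1; apply/eqP; rewrite -subr_eq0; apply: contraNT u1 => t1.
have /center_GL2P[a] : u ^+ 3 \in Z.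
  by apply: coset_idr; rewrite ?GL2_normZ // morphX ?GL2_normZ.
rewrite val_cube cube_mx2 du mulr1 => /eqP; rewrite subr_eq -raddfD => /eqP ua.
apply/eqP/coset_id/center_GL2P; set c := (_ - 1)%R in t1 ua.
exists (c^-1 * (a + \tr (val u)))%R.
by rewrite -scale_scalar_mx -ua scalerA mulVf ?scale1r.
Qed.

(** A scalar matrix of determinant 1 has squared trace 4, and 4 = 1 would mean 3 = 0. *)
Lemma tr_coset_neq1 u : (3 != 0 :> F)%R -> u \in SL2 F ->
  (\tr (val u) ^+ 2 = 1)%R -> coset Z u != 1.
Proof.
move=> F3; rewrite inE => /eqP du tu; apply: contraNneq F3 => u1.
have /center_GL2P[a ua] : u \in Z by apply: coset_idr; rewrite ?GL2_normZ.
move: du tu; rewrite ua scalar_mx2 det_mx2 tr_mx2 mulr0 subr0 => a1.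
have -> : ((a + a) ^+ 2 = 4 * (a * a))%R by ring.
by rewrite a1 => e; apply/eqP; transitivity (4 * 1 - 1 : F)%R; [ring | rewrite e subrr].
Qed.

(** Any lift has trace 1 or -1; in the second case it is multiplied by the central element [z],
    which is minus the identity. *)
Lemma PSL2_order3_lift x : x \in PSL2 F -> x ^+ 3 = 1 -> x != 1 ->
  exists u, [/\ u \in SL2 F, (\tr (val u) = 1)%R & x = coset Z u].
Proof.
case/morphimP=> u _ SLu -> u3 u1; have := tr_coset_cube1 SLu u3 u1.
move/eqP; rewrite sqrf_eq1 => /orP[] /eqP tu; first by exists u.
have [z zE] : {z : {'GL_2[F]} | val z = (-1)%:M}%R.
  by apply: GL2_of_det; rewrite det_scalar sqrrN expr1n oner_neq0.
have Zz : z \in Z by apply/center_GL2P; exists (-1)%R.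
have zu : (val (z * u)%g = - val u)%R by rewrite val_GL2M zE mul_scalar_mx scaleN1r.
exists (z * u); split.
- move: SLu; rewrite !inE zu; case: (val u) / mx2P => a b c d.
  by rewrite opp_mx2 !det_mx2 !mulrNN.
- by rewrite zu linearN /= tu opprK.
by rewrite morphM ?GL2_normZ //= (coset_id Zz) mul1g.
Qed.

(* A vector [v] that is not an eigenvector turns [M] into its companion matrix
   in the basis [(v, v M)]. *)
Lemma conj_companion u : u \in SL2 F -> (\tr (val u) = 1)%R -> coset Z u != 1 ->
  exists g, (val g *m val u = mx2 0 1 (-1) 1 *m val g)%R.
Proof.
rewrite inE; have : (exists a, val u = a%:M)%R -> coset Z u = 1.
  by move/center_GL2P/coset_id.
case: (val u) / mx2P => a b c d scal.
rewrite det_mx2 tr_mx2 => /eqP du tu u1.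
suff [x [y xy]] : exists x y : F, (x * (x * b + y * d) - y * (x * a + y * c) != 0)%R.
  have [g gE] : {g : {'GL_2[F]} | val g = mx2 x y (x * a + y * c) (x * b + y * d)}%R.
    by apply: GL2_of_det; rewrite det_mx2.
  exists g; rewrite gE !mulmx2; have dE : d = (1 - a)%R by rewrite -tu addrC addKr.
  have bc : (b * c = a * (1 - a) - 1)%R.
    by transitivity (a * d - (a * d - b * c))%R; [ring | rewrite du dE].
  rewrite dE; congr mx2; try ring.
    transitivity (x * (a * a + b * c) + y * c)%R; [ring | rewrite bc; ring].
  transitivity (x * b + y * (b * c + (1 - a) * (1 - a)))%R; [ring | rewrite bc; ring].
(* The vectors (1, 0), (0, 1) and (1, 1) are tried in turn; a matrix having all three as
   eigenvectors is scalar. *)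
case: (eqVneq b 0%R) => [b0|b0]; last first.
  by exists 1%R, 0%R; rewrite !(mul0r, addr0, subr0, mul1r).
case: (eqVneq c 0%R) => [c0|c0]; last first.
  by exists 0%R, 1%R; rewrite !(mul0r, add0r, mul1r) oppr_eq0.
exists 1%R, 1%R; rewrite b0 c0 !(mul1r, addr0, add0r) subr_eq0.
apply: contraNneq u1 => da; apply/eqP/scal.
by exists a; rewrite b0 c0 da scalar_mx2.
Qed.

(** Lifts of trace 1 are both conjugate in GL(2, q) to the companion matrix [c] of X^2 - X + 1. *)
Lemma PSL2_order3_conj x y : x \in PSL2 F -> x ^+ 3 = 1 -> x != 1 ->
    y \in PSL2 F -> y ^+ 3 = 1 -> y != 1 ->
  exists2 z, z \in PGL2 F & y = x ^ z.
Proof.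
move=> Px x3 x1 Py y3 y1.
have [u [SLu tu xu]] := PSL2_order3_lift Px x3 x1; rewrite xu in x1 *.
have [w [SLw tw yw]] := PSL2_order3_lift Py y3 y1; rewrite yw in y1 *.
have [g gu] := conj_companion SLu tu x1; have [h hw] := conj_companion SLw tw y1.
have [c cE] : {c : {'GL_2[F]} | val c = mx2 0 1 (-1) 1}%R.
  by apply: GL2_of_det; rewrite det_mx2 mul0r mul1r sub0r opprK oner_neq0.
have gu' : g * u = c * g by apply: val_inj; rewrite !val_GL2M cE gu.
have hw' : h * w = c * h by apply: val_inj; rewrite !val_GL2M cE hw.
have wE : w = u ^ (g^-1 * h).
  rewrite conjgE invMg invgK !mulgA -(mulgA _ g u) gu' !mulgA mulgK.
  by rewrite -mulgA -hw' mulKg.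
exists (coset Z (g^-1 * h)); first by rewrite mem_quotient ?in_setT.
by rewrite wE morphJ ?GL2_normZ.
Qed.

End ProjectiveGroups.

(** * When 5 is a square in the field *)

Section SquareRootOfFive.

Local Open Scope ring_scope.

Variable F : finFieldType.

(* In the quaternion algebra ['M_2] with [i^2 = j^2 = -1] and [k = i j], the
   three matrices are [(1+i+j+k)/2], [(1+i+j-k)/2] and
   [1/2 + (1-r)/4 i + (1+r)/4 j]. *)
Lemma clique4_of_five_square (r : F) : odd #|F| -> r ^+ 2 = 5 ->
  exists M1 M2 M3 : 'M[F]_2,
    [/\ \det M1 = 1, \det M2 = 1 & \det M3 = 1] /\
    [/\ \tr M1 = 1, \tr M2 = 1 & \tr M3 = 1] /\
    [/\ polar_det M1 M2 = 1, polar_det M1 M3 = 1 & polar_det M2 M3 = 1].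
Proof.
move=> oddF r5; have F2 := finField_two_neq0 oddF.
have [x [y xy]] := minus1_sum_two_squares oddF.
(* [s] and [t] solve s + t = 1/2 and s^2 + t^2 = 3/4, the conditions for the third quaternion to
   have norm 1 and polar value 1 with the other two; this is a quadratic equation of discriminant
   5/4. *)
pose h : F := 2^-1; pose s := h * (h * (1 - r)); pose t := h * (h * (1 + r)).
have h2 : 2 * h = 1 by rewrite mulfV.
have st : s + t = h by rewrite -[RHS]mulr1 -[X in _ = _ * X]h2 /s /t; ring.
have sst : s ^+ 2 + t ^+ 2 = 1 - h ^+ 2.
  transitivity (2 * h ^+ 4 * (1 + r ^+ 2)); first by rewrite /s /t; ring.
  rewrite r5; transitivity ((2 * h) ^+ 4 - (2 * h) ^+ 2 * h ^+ 2); first by ring.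
  by rewrite h2 !expr1n mul1r.
(* [j] represents a + b i + c j + d k as a matrix, the relation x^2 + y^2 = -1 giving j^2 = -1;
   determinant and trace are the quaternion norm and trace. *)
pose j a b c d := mx2 (a + c * x - d * y) (- b + c * y + d * x)
  (b + c * y + d * x) (a - c * x + d * y).
have jdet a b c d : \det (j a b c d) = a ^+ 2 + b ^+ 2 + c ^+ 2 + d ^+ 2.
  rewrite det_mx2.
  transitivity (a ^+ 2 + b ^+ 2 - (x ^+ 2 + y ^+ 2) * (c ^+ 2 + d ^+ 2)); first by ring.
  by rewrite xy; ring.
have jtr a b c d : \tr (j a b c d) = 2 * a by rewrite tr_mx2; ring.
have jpolar a b c d a' b' c' d' : polar_det (j a b c d) (j a' b' c' d') =
    2 * (a * a' + b * b' + c * c' + d * d').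
  rewrite polar_det_mx2.
  transitivity (2 * (a * a' + b * b' - (x ^+ 2 + y ^+ 2) * (c * c' + d * d'))).
    by ring.
  by rewrite xy; ring.
exists (j h h h h), (j h h h (- h)), (j h s t 0).
rewrite !jdet !jtr !jpolar h2.
have hh : 2 * h * (2 * h) = 1 by rewrite h2 mulr1.
do !split=> //.
- by transitivity (2 * h * (2 * h)); [ring | ].
- by transitivity (2 * h * (2 * h)); [ring | ].
- by rewrite expr0n addr0 -addrA sst addrC subrK.
- by transitivity (2 * h * (2 * h)); [ring | ].
- by transitivity (2 * h * (h + (s + t))); [ring | rewrite st h2 mul1r -h2; ring].
by transitivity (2 * h * (h + (s + t))); [ring | rewrite st h2 mul1r -h2; ring].
Qed.

(* The companion matrix of [X^2 - s X + 1] with [s = (r - 1) / 2] has order 5. *)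
Lemma dvd5_card_GL2 (r : F) : odd #|F| -> r ^+ 2 = 5 -> (5 %| #|'GL_2[F]%g|)%N.
Proof.
move=> oddF r5; have F2 := finField_two_neq0 oddF.
pose s := (r - 1) / 2.
have s2 : s ^+ 2 = 1 - s.
  have s_def : 2 * s = r - 1 by rewrite mulrC divfK.
  apply: (mulfI F2); apply: (mulfI F2).
  transitivity ((2 * s) ^+ 2); first by ring.
  rewrite s_def; transitivity (r ^+ 2 + 1 - 2 * r); first by ring.
  by rewrite r5; transitivity (4 - 2 * (2 * s)); [rewrite s_def; ring | ring].
have [u uE] : {u : {'GL_2[F]} | val u = mx2 0 1 (-1) s}.
  by apply: GL2_of_det; rewrite det_mx2 mul0r mul1r sub0r opprK oner_neq0.
have u2 : val (u * u)%g = mx2 (- 1) s (- s) (- s).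
  rewrite val_GL2M uE mulmx2; congr mx2; try ring.
  by rewrite -expr2 s2; ring.
have u4 : val (u * u * (u * u))%g = mx2 s (- 1) 1 0.
  rewrite val_GL2M u2 mulmx2; congr mx2; rewrite ?mulNr ?mulrN ?opprK -?expr2 ?s2; ring.
have u5 : (u ^+ 5 = 1)%g.
  apply: val_inj; rewrite expgS (_ : u ^+ 4 = u * u * (u * u))%g; last first.
    by rewrite !expgS mulg1 !mulgA.
  rewrite val_GL2M u4 uE mulmx2 [RHS]scalar_mx2; congr mx2; ring.
have u1 : (u != 1)%g.
  apply: contraTneq isT => u1; move: uE; rewrite u1 [LHS]scalar_mx2.
  by case/mx2_inj=> /eqP; rewrite oner_eq0.
have := order_dvdG (in_setT u : u \in 'GL_2[F]%g); apply: dvdn_trans.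
by have /prime_nt_dvdP -> : (#[u]%g %| 5)%N; rewrite ?order_dvdn ?u5 // order_eq1.
Qed.

(** The root is the quadratic Gauss sum z - z^2 - z^3 + z^4, rewritten with 1 + z + z^2 + z^3 + z^4
    = 0. *)
Lemma sqrt5_of_root5 (z : F) : z ^+ 5 = 1 -> z != 1 -> exists r : F, r ^+ 2 = 5.
Proof.
move=> z5 z1; have z4 : 1 + z + z ^+ 2 + z ^+ 3 + z ^+ 4 = 0.
  have z1' : z - 1 != 0 by rewrite subr_eq0.
  apply: (mulfI z1'); rewrite mulr0; transitivity (z ^+ 5 - 1); first by ring.
  by rewrite z5 subrr.
exists (1 + 2 * (z + z ^+ 4)).
transitivity (5 + 4 * (1 + z + z ^+ 2 + z ^+ 3 + z ^+ 4) + (4 * z ^+ 3 + 8) * (z ^+ 5 - 1)).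
  by ring.
by rewrite z4 z5 subrr !mulr0 !addr0.
Qed.

Lemma sqrt5_of_card1 : #|F| = 1 %[mod 5] -> exists r : F, r ^+ 2 = 5.
Proof.
move=> F5; have : (5 %| #|[set: {unit F}]|)%N.
  by rewrite card_finField_unit -subn1 -eqn_mod_dvd ?F5 // ltnW // finNzRing_gt1.
case/Cauchy=> // z _ z5; apply: (@sqrt5_of_root5 (val z)).
  by rewrite -FinRing.val_unitX -z5 expg_order.
by apply: contra_eq_neq z5 => z1; rewrite (_ : z = 1%g) ?order1 //; apply: val_inj.
Qed.

Lemma mx2_pow5 (R : comNzRingType) (M : 'M[R]_2) :
  M *m M *m (M *m M) *m M =
  (\tr M ^+ 4 - 3 * \tr M ^+ 2 * \det M + \det M ^+ 2) *: M
  - (\tr M ^+ 3 * \det M - 2 * \tr M * \det M ^+ 2)%:M.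
Proof.
case: M / mx2P => a b c d; rewrite !mulmx2 tr_mx2 det_mx2.
by rewrite [RHS]mx2_eta !mxE /=; congr mx2; ring.
Qed.

(** Here 5 divides q + 1, hence the order of GL(2, q), and Cauchy gives a matrix of order 5. Its
    eigenvalues would be a fifth root of unity and its inverse, so its trace is a root of X^2 + X -
    1, of discriminant 5. *)
Lemma sqrt5_of_card4 : #|F| = 4 %[mod 5] -> exists r : F, r ^+ 2 = 5.
Proof.
move=> F5; have : (5 %| #|'GL_2[F]%g|)%N.
  by rewrite card_GL_2 dvdn_mull //; lia.
case/Cauchy=> // u _ u5.
have : val (u ^+ 5)%g = 1%:M by rewrite -u5 expg_order.
rewrite (_ : u ^+ 5 = u * u * (u * u) * u)%g; last by rewrite !expgS mulg1 !mulgA.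
rewrite !val_GL2M; set M := val u => M5; set t := \tr M; set d := \det M.
have d5 : d ^+ 5 = 1 by rewrite -(det1 F 2) -M5 !det_mulmx !exprS expr0 mulr1 !mulrA.
have d1 : d = 1.
  have d0 : d != 0 by apply: GL_det.
  (* As q = 4 mod 5, [d ^+ q = d] gives d^4 = d, so d^2 = d^5 = 1 and d = d^4 = 1. *)
  have := expf_card d; rewrite (divn_eq #|F| 5) F5 exprD mulnC exprM d5 expr1n mul1r.
  rewrite (_ : 4 %% 5 = 4)%N // => d4.
  have dd : d * d = 1 by rewrite -d5 exprS d4.
  by rewrite -d4 -[4%N]/(2 * 2)%N exprM (expr2 d) dd expr1n.
have := mx2_pow5 M; rewrite M5 -/t -/d d1 !mulr1 !expr1n !mulr1.
set alpha := (_ + 1); set beta := (_ - 2 * t) => CH.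
(* Since [alpha] times M minus [beta] is the identity, a nonzero [alpha] makes M a scalar [a] with
   a^2 = a^5 = 1, so trivial, against order 5. *)
have [alpha0 | alpha0] := eqVneq alpha 0; last first.
  have /center_GL2P Zu : exists a, val u = a%:M.
    exists (alpha^-1 * (1 + beta)); rewrite -scale_scalar_mx raddfD /= CH subrK scalerA.
    by rewrite mulVf // scale1r.
  have /center_GL2P[a ua] := Zu.
  exfalso; suff u1 : u = 1%g by move: u5; rewrite u1 order1.
  move: d1 M5; rewrite /d /M ua det_scalar expr2 -!scalar_mxM => aa.
  by rewrite aa mulr1 mul1r => a1; apply: val_inj; rewrite ua a1.
have beta1 : beta = -1.
  move: CH; rewrite alpha0 scale0r sub0r -raddfN /= !scalar_mx2.
  by case/mx2_inj=> -> _ _ _; rewrite opprK.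
have r5 : t ^+ 2 + t - 1 = 0 -> exists r : F, r ^+ 2 = 5.
  move=> t5; exists (2 * t + 1); transitivity (4 * (t ^+ 2 + t - 1) + 5); first by ring.
  by rewrite t5 mulr0 add0r.
(* The product is [beta + 1]; the factor t = 1 is ruled out because it would give [alpha] = -1. *)
have /eqP : (t - 1) * (t ^+ 2 + t - 1) = 0.
  by transitivity (beta + 1); [rewrite /beta; ring | rewrite beta1 addNr].
rewrite mulf_eq0 subr_eq0 => /orP[] /eqP // t1.
move/eqP: alpha0; rewrite /alpha t1; rewrite (_ : _ + _ = -1); last by ring.
by rewrite oppr_eq0 oner_eq0.
Qed.

(** From left to right, an element of order 5 forces 5 to divide q (q - 1)^2 (q + 1), the order of
    GL(2, q). Conversely, q = 0 mod 5 means characteristic 5, where 5 = 0 is a square. *)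
Lemma sqrt5P : odd #|F| ->
  (exists r : F, r ^+ 2 = 5) <->
  [\/ #|F| = 0 %[mod 5], #|F| = 1 %[mod 5] | #|F| = 4 %[mod 5]].
Proof.
move=> oddF; split=> [[r r5] |]; last first.
  case=> [F5 | /sqrt5_of_card1 // | /sqrt5_of_card4 //].
  exists 0; rewrite expr0n /=; apply/esym/eqP.
  have : (5 %| #|[set: F]|)%N by rewrite cardsT /dvdn F5.
  case/Cauchy=> // x _ x5.
  have /eqP : x *+ 5 = 0 by rewrite -x5 -FinRing.zmodXgE expg_order.
  rewrite -(mulr_natr x) mulf_eq0 => /orP[/eqP x0 | //].
  by move: x5; rewrite x0 order1.
have := dvd5_card_GL2 oddF r5; rewrite card_GL_2.
rewrite Euclid_dvdM // Euclid_dvdM // Euclid_dvdX // andbT.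
have := finNzRing_gt1 F; move: #|F| => q q1.
case/orP=> [/orP[] |] q5; [apply: Or31 | apply: Or32 | apply: Or33]; lia.
Qed.

End SquareRootOfFive.

(** * Cubic graphs with an arc-regular group *)

Section CubicArcRegular.

Local Open Scope group_scope.

Variables (V : finType) (adj : rel V) (G : {group {perm V}}).
Hypotheses (X_simple : simple_graph adj) (X_cubic : cubic adj).
Hypothesis G_arc_regular : arc_regular adj 1 G.

Lemma mem_arcs1 v w : adj v w -> [tuple v; w] \in arcs adj 1.
Proof.
move=> vw; rewrite inE /= vw !andbT inE.
by apply: contraTneq vw => ->; rewrite X_simple.2.
Qed.

Lemma card_arcs1 : #|arcs adj 1| = (3 * #|V|)%N.
Proof.
pose f (p : V * V) : 2.-tuple V := [tuple p.1; p.2].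
have f_inj : injective f by move=> [a b] [c d] /(congr1 val) [-> ->].
have -> : arcs adj 1 = f @: [set p | adj p.1 p.2].
  apply/setP=> t; apply/idP/imsetP => [| [[v w]]]; last first.
    by rewrite inE /= => vw ->; apply: mem_arcs1.
  case/tupleP: t => v t; case/tupleP: t => w t.
  rewrite (tuple0 t) inE /= => /andP[_ /andP[vw _]].
  by exists (v, w); rewrite ?inE //; apply: val_inj.
rewrite card_imset //; transitivity (\sum_v \sum_(w | adj v w) 1)%N.
  by rewrite pair_big_dep /= sum1dep_card.
rewrite (eq_bigr (fun=> 3)) ?sum_nat_const 1?mulnC // => v _.
by rewrite sum1dep_card; apply/eqP; apply: (forallP X_cubic).
Qed.

Lemma card_arc_regular : #|G| = (3 * #|V|)%N.
Proof.
case/andP: G_arc_regular => trG /forallP stG; rewrite -card_arcs1.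
have [t At defA] := imsetP trG.
have /eqP st := implyP (stG t) At.
have := card_orbit_stab ('P * 2)%act G t; rewrite st cards1 muln1 => <-.
by rewrite defA.
Qed.

Lemma arc_regular_card_gt0 : 0 < #|V|.
Proof.
by case/andP: G_arc_regular => /imsetP[t _ _] _; apply/card_gt0P; exists (thead t).
Qed.

Lemma exists_neighbour v : exists w, adj v w.
Proof.
have /card_gt0P[w] : 0 < #|[set w | adj v w]| by rewrite (eqP (forallP X_cubic v)).
by rewrite inE; exists w.
Qed.

Lemma arc_regular_orbit v : orbit 'P G v = [set: V].
Proof.
case/andP: G_arc_regular => trG _; apply/setP=> w; rewrite inE; apply/orbitP.
have [v' vv'] := exists_neighbour v; have [w' ww'] := exists_neighbour w.
have [g Gg /(congr1 val) [wg _]] := atransP2 trG (mem_arcs1 vv') (mem_arcs1 ww').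
by exists g.
Qed.

Lemma card_arc_regular_stab v : #|'C_G[v | 'P]| = 3.
Proof.
have := card_orbit_stab 'P G v; rewrite arc_regular_orbit cardsT card_arc_regular mulnC.
by move/eqP; rewrite eqn_pmul2r; [move/eqP | apply/card_gt0P; exists v].
Qed.

(** Regularity on the 3 |V| arcs makes |G| / |V| = 3, so only the largest size of an intersecting
    set remains to be found. *)
Lemma intersection_density_arc_regular n :
    (forall A : {set {perm V}}, A \subset G -> intersecting A -> (#|A| <= n)%N) ->
    (exists A : {set {perm V}}, [/\ A \subset G, intersecting A & #|A| = n]) ->
  intersection_density G = (n%:R / 3%:R)%R.
Proof.
move=> ub [A [AG iA cA]]; rewrite /intersection_density.
have -> : (\max_(B : {set {perm V}} | (B \subset G) && intersecting B) #|B|)%N = n.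
  apply/eqP; rewrite eqn_leq -{2}cA; apply/andP; split.
    by apply/bigmax_leqP => B /andP[BG iB]; apply: ub.
  by apply: leq_bigmax_cond; rewrite AG.
by rewrite card_arc_regular natrM mulfK // Num.Theory.pnatr_eq0 -lt0n arc_regular_card_gt0.
Qed.

Lemma intersectingP (A : {set {perm V}}) :
  reflect {in A &, forall f g : {perm V}, exists v, f v = g v} (intersecting A).
Proof.
apply: (iffP forall_inP) => [iA f g Af Ag | iA f Af].
  by have /forall_inP/(_ g Ag)/existsP[v /eqP] := iA f Af; exists v.
by apply/forall_inP=> g Ag; have [v fg] := iA f g Af Ag; apply/existsP; exists v; apply/eqP.
Qed.

Lemma stab_intersecting v : intersecting 'C_G[v | 'P].
Proof.
apply/intersectingP => f g /setIP[_ /astab1P fv] /setIP[_ /astab1P gv].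
by exists v; rewrite [LHS]fv [RHS]gv.
Qed.

Lemma fix_cube1 f v : f \in G -> f v = v -> f ^+ 3 = 1.
Proof.
move=> Gf fv; rewrite -(card_arc_regular_stab v); apply: expg_cardG.
by rewrite inE Gf; apply/astab1P.
Qed.

End CubicArcRegular.

(** * Intersecting sets in PSL(2, q) as cliques of the polar form *)

Section PSL2Action.

Local Open Scope group_scope.

Variable F : finFieldType.
Hypotheses (oddF : odd #|F|) (F_mod3 : #|F| = 2 %[mod 3]).
Variables (V : finType) (adj : rel V).
Hypotheses (X_simple : simple_graph adj) (X_cubic : cubic adj).
Variables (iota : {morphism PGL2 F >-> {perm V}}) (G : {group {perm V}}).
Hypotheses (iota_inj : 'injm iota) (G_def : G = iota @* PSL2 F :> {set {perm V}}).
Hypothesis G_arc_regular : arc_regular adj 1 G.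

Implicit Types f g : {perm V}.

Let F3 : (3 != 0 :> F)%R.
Proof. exact: finField_three_neq0 F_mod3 (finField_two_neq0 oddF). Qed.

Lemma PSL2_sub_PGL2 : PSL2 F \subset PGL2 F.
Proof. exact: quotientS (subsetT _). Qed.

(** A vertex stabiliser contains an element [h] of order 3 fixing [v0]. A nontrivial [f] is
    conjugate to [h] by some [iota z] with [z] in PGL(2, q), and therefore fixes [iota z v0]. *)
Lemma cube1_fix f : f \in G -> f ^+ 3 = 1 -> exists v, f v = v.
Proof.
have /card_gt0P[v0 _] := arc_regular_card_gt0 G_arc_regular.
have [-> | f1] := eqVneq f 1; first by exists v0; rewrite perm1.
have lift g : g \in G -> g ^+ 3 = 1 -> g != 1 ->
    exists x, [/\ x \in PSL2 F, x ^+ 3 = 1, x != 1 & g = iota x].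
  rewrite G_def => /morphimP[x Px PSx ->]; rewrite -morphX // => x3 x1.
  exists x; split=> //; last by apply: contraNneq x1 => ->; rewrite morph1.
  by apply: (injmP iota_inj); rewrite ?morph1 ?groupX ?group1.
have : 'C_G[v0 | 'P] != 1.
  have := card_arc_regular_stab X_simple X_cubic G_arc_regular v0.
  by apply: contra_eqN => /eqP->; rewrite cards1.
case/trivgPn=> h /setIP[Gh /astab1P hv] h1 Gf f3.
have h3 := fix_cube1 X_simple X_cubic G_arc_regular Gh hv.
have [x [Px x3 x1 fE]] := lift f Gf f3 f1.
have [y [Py y3 y1 hE]] := lift h Gh h3 h1.
have [z Pz xE] := PSL2_order3_conj Py y3 y1 Px x3 x1.
exists (iota z v0); rewrite fE xE morphJ ?(subsetP PSL2_sub_PGL2 y Py) //.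
by rewrite -hE conjgE !permM permK [h v0]hv.
Qed.

Lemma intersect_cube1 f g : f \in G -> g \in G ->
  (exists v, f v = g v) <-> (f * g^-1) ^+ 3 = 1.
Proof.
move=> Gf Gg; have Gfg : f * g^-1 \in G by rewrite groupM ?groupV.
split=> [[v fg] | /(cube1_fix Gfg)[v]].
  by apply: (fix_cube1 X_simple X_cubic G_arc_regular (v := v)); rewrite // permM fg permK.
by rewrite permM => /(canRL (permKV g)) fg; exists v.
Qed.

Local Notation Z := 'Z('GL_2[F]).
Definition sl2_action (u : {'GL_2[F]}) : {perm V} := iota (coset Z u).

Lemma mem_coset_PSL2 u : u \in SL2 F -> coset Z u \in PSL2 F.
Proof. exact: mem_quotient. Qed.

Lemma sl2_action_mem u : u \in SL2 F -> sl2_action u \in G.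
Proof.
move=> /mem_coset_PSL2 Pu.
by rewrite G_def mem_morphim // (subsetP PSL2_sub_PGL2).
Qed.

Lemma sl2_action_lift f : f \in G -> exists2 u, u \in SL2 F & f = sl2_action u.
Proof. by rewrite G_def => /morphimP[_ _ /morphimP[u _ Su ->] ->]; exists u. Qed.

Lemma sl2_action_div u w : u \in SL2 F -> w \in SL2 F ->
  sl2_action u * (sl2_action w)^-1 = sl2_action (u * w^-1).
Proof.
move=> Su Sw; have P := fun t St => subsetP PSL2_sub_PGL2 _ (@mem_coset_PSL2 t St).
rewrite /sl2_action -morphV ?P // -morphM ?groupV ?P //.
by rewrite -morphV ?GL2_normZ //= -morphM ?groupV ?GL2_normZ.
Qed.

(** Meeting at a vertex says that the class of [u * w^-1] has trivial cube, and distinctness that it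
    is nontrivial; together this is trace 1 or -1. *)
Lemma sl2_action_intersect u w : u \in SL2 F -> w \in SL2 F ->
  (sl2_action u != sl2_action w /\ exists v, sl2_action u v = sl2_action w v)
  <-> (polar_det (val u) (val w) ^+ 2 = 1)%R.
Proof.
move=> Su Sw; have Suw : u * w^-1 \in SL2 F by rewrite groupM ?groupV.
have Puw := subsetP PSL2_sub_PGL2 _ (mem_coset_PSL2 Suw).
rewrite intersect_cube1 ?sl2_action_mem // sl2_action_div // -tr_quotient_SL2 //.
have neq : (sl2_action u != sl2_action w) = (coset Z (u * w^-1) != 1).
  rewrite eq_mulgV1 sl2_action_div // -(inj_in_eq (injmP iota_inj) Puw (group1 _)).
  by rewrite morph1.
rewrite neq; split=> [[uw1 uw3] | t1].
  apply: tr_coset_cube1 => //.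
  by apply: (injmP iota_inj); rewrite ?groupX ?group1 // morphX // morph1.
split; first exact: tr_coset_neq1.
by rewrite /sl2_action -morphX // coset_cube1_tr ?morph1.
Qed.

(** The default 1 is never returned on [G], where every element has a lift. *)
Let lift f : {'GL_2[F]} := odflt 1 [pick u in SL2 F | sl2_action u == f].

Let liftP f : f \in G -> lift f \in SL2 F /\ sl2_action (lift f) = f.
Proof.
move=> Gf; rewrite /lift; case: pickP => [u /andP[Su /eqP] // | no].
have [u Su fu] := sl2_action_lift Gf.
by have /negP[] := negbT (no u); rewrite Su fu eqxx.
Qed.

Let det_lift f : f \in G -> (\det (val (lift f)) = 1)%R.
Proof. by case/liftP; rewrite inE => /eqP. Qed.

Let polar_lift (A : {set {perm V}}) f g : A \subset G -> intersecting A ->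
  f \in A -> g \in A -> f != g -> (polar_det (val (lift f)) (val (lift g)) ^+ 2 = 1)%R.
Proof.
move=> AG /intersectingP iA Af Ag fg.
have [Sf fE] := liftP (subsetP AG f Af); have [Sg gE] := liftP (subsetP AG g Ag).
apply/(sl2_action_intersect Sf Sg).
by rewrite fE gE; split=> //; apply: iA.
Qed.

(** Choosing lifts passes from permutations to matrices, so that the bounds on cliques of the polar
    form apply. *)
Lemma intersecting_polar_clique (A : {set {perm V}}) n :
    A \subset G -> intersecting A -> n <= #|A| ->
  exists M : nat -> 'M[F]_2, (forall i, i < n -> (\det (M i) = 1)%R) /\
    (forall i j, i < n -> j < n -> i != j -> (polar_det (M i) (M j) ^+ 2 = 1)%R).
Proof.
move=> AG iA /card_geqP[s [Us size_s sA]].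
have sP i : i < n -> nth 1 s i \in A by move=> lt_i; rewrite sA ?mem_nth ?size_s.
exists (fun i => val (lift (nth 1 s i))); split=> [i | i j] lt_i.
  by apply: det_lift; apply: (subsetP AG); apply: sP.
move=> lt_j ij; apply: (polar_lift AG iA); rewrite ?sP //.
by rewrite nth_uniq ?size_s.
Qed.

Let m3_nonsquare (s : F) : (s ^+ 2 != - 3)%R.
Proof. exact: minus3_nonsquare. Qed.

Lemma card_intersecting_le4 (A : {set {perm V}}) :
  A \subset G -> intersecting A -> #|A| <= 4.
Proof.
move=> AG iA; rewrite leqNgt; apply/negP.
case/(intersecting_polar_clique AG iA)=> M [dM pM].
by apply: (@no_clique5 F (finField_two_neq0 oddF) F3 m3_nonsquare
  (M 0%N) (M 1%N) (M 2%N) (M 3%N) (M 4%N)); by [apply: dM | apply: pM].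
Qed.

Lemma card_intersecting_le3 (A : {set {perm V}}) : ~ (exists r : F, r ^+ 2 = 5)%R ->
  A \subset G -> intersecting A -> #|A| <= 3.
Proof.
move=> no5 AG iA; rewrite leqNgt; apply/negP.
case/(intersecting_polar_clique AG iA)=> M [dM pM].
by apply: no5; apply: (@five_square_of_clique4 F (finField_two_neq0 oddF) F3 m3_nonsquare
  (M 0%N) (M 1%N) (M 2%N) (M 3%N)); by [apply: dM | apply: pM].
Qed.

(** The set consists of the identity and the three icosian matrices; trace 1 is polar value 1 with
    the identity. *)
Lemma intersecting_card4 (r : F) : (r ^+ 2 = 5)%R ->
  exists A : {set {perm V}}, [/\ A \subset G, intersecting A & #|A| = 4].
Proof.
move=> r5; have [M1 [M2 [M3 [[d1 d2 d3] [[t1 t2 t3] [p12 p13 p23]]]]]] :=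
  clique4_of_five_square oddF r5.
have lift1 (M : 'M[F]_2) : (\det M = 1)%R -> {u | u \in SL2 F & val u = M}.
  move=> d; have [|u uM] := @GL2_of_det F M; first by rewrite d oner_neq0.
  by exists u; rewrite // inE uM d.
have [u1 S1 E1] := lift1 M1 d1; have [u2 S2 E2] := lift1 M2 d2.
have [u3 S3 E3] := lift1 M3 d3.
have S0 : 1 \in SL2 F by apply: group1.
have E0 : val (1 : {'GL_2[F]}) = 1%:M%R by [].
have meet u w : u \in SL2 F -> w \in SL2 F -> polar_det (val u) (val w) = 1%R ->
    sl2_action u != sl2_action w /\
    exists v, sl2_action u v = sl2_action w v.
  move=> Su Sw p.
  apply/(sl2_action_intersect Su Sw).
  by rewrite p expr1n.
have p1 (M : 'M[F]_2) : (\tr M = 1 -> polar_det 1%:M M = 1)%R.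
  by rewrite polar_detC polar_det1.
have [n01 m01] := meet 1 u1 S0 S1 ltac:(by rewrite E0 E1 p1).
have [n02 m02] := meet 1 u2 S0 S2 ltac:(by rewrite E0 E2 p1).
have [n03 m03] := meet 1 u3 S0 S3 ltac:(by rewrite E0 E3 p1).
have [n12 m12] := meet u1 u2 S1 S2 ltac:(by rewrite E1 E2).
have [n13 m13] := meet u1 u3 S1 S3 ltac:(by rewrite E1 E3).
have [n23 m23] := meet u2 u3 S2 S3 ltac:(by rewrite E2 E3).
exists [set f in map sl2_action [:: 1; u1; u2; u3]]; split.
- apply/subsetP=> f; rewrite inE => /mapP[u us ->]; apply: sl2_action_mem.
  by move: us; rewrite !in_cons in_nil orbF => /or4P[] /eqP->.
(* Of the 16 pairs, the diagonal ones agree at an arbitrary [v0], and the others follow from the six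
   meetings above, up to symmetry. *)
- apply/intersectingP => f g; rewrite !inE => /or4P[] /eqP-> /or4P[] /eqP->;
    have [v0 _] := card_gt0P (arc_regular_card_gt0 G_arc_regular);
    by [exists v0 | assumption |
      match goal with H : exists v, ?a v = ?b v |- exists v, ?b v = ?a v =>
        case: H => v Hv; exists v; rewrite Hv end].
rewrite cardsE; apply/card_uniqP; rewrite /= !inE !negb_or.
by rewrite n01 n02 n03 n12 n13 n23.
Qed.

End PSL2Action.

(** * The values of the intersection density *)

Theorem theorem6p5 (p k q : nat) (p_prime : prime p) (k_gt0 : (0 < k)%N)
    (qE : q = (p ^ k)%N) (q_odd : odd q) (q_mod3 : q = 2 %[mod 3])
    (F : finFieldType) (cardF : #|F| = q)
    (V : finType) (adj : rel V) (X_simple : simple_graph adj)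
    (X_cubic : cubic adj) (X_arc_transitive : arc_transitive adj)
    (X_type : type_1_21 adj)
    (iota : {morphism PGL2 F >-> {perm V}})
    (Aut_X : isom (PGL2 F) (graph_aut adj) iota)
    (G : {group {perm V}}) (G_def : G = (iota @* PSL2 F)%g :> {set {perm V}})
    (G_arc_regular : arc_regular adj 1 G) :
  [/\ (exists j : nat, q = (5 ^ (2 * j + 1))%N) ->
        intersection_density G = (4%:R / 3%:R)%R,
      q = 2 %[mod 5] \/ q = 3 %[mod 5] -> intersection_density G = 1%R
    & q = 1 %[mod 5] \/ q = 4 %[mod 5] ->
        intersection_density G = (4%:R / 3%:R)%R].
Proof.
clear qE; subst q; have /isomP[iota_inj _] := Aut_X.
have sq5 := sqrt5P q_odd.
have density4 : [\/ #|F| = 0 %[mod 5], #|F| = 1 %[mod 5] | #|F| = 4 %[mod 5]] ->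
    intersection_density G = (4%:R / 3%:R)%R.
  case/sq5 => r r5.
  apply: (intersection_density_arc_regular X_simple X_cubic G_arc_regular).
    exact: (card_intersecting_le4 q_odd q_mod3 X_simple X_cubic iota_inj G_def G_arc_regular).
  exact: (intersecting_card4 q_odd q_mod3 X_simple X_cubic iota_inj G_def G_arc_regular r5).
split=> [[j q5] | q23 | [] q5]; last first.
- exact: density4 (Or33 _ _ q5).
- exact: density4 (Or32 _ _ q5).
all: cycle 1.
- by apply/density4/Or31; rewrite q5 addn1 expnS modnMr.
(* The value 1 is read as 3 / 3: with 5 a nonsquare, 3 is an upper bound, and a vertex stabiliser
   attains it. *)
rewrite -[RHS](@divff _ 3%:R) //.
apply: (intersection_density_arc_regular X_simple X_cubic G_arc_regular) => [A|].
  apply: (card_intersecting_le3 q_odd q_mod3 X_simple X_cubic iota_inj G_def G_arc_regular).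
  by case/sq5; case: q23 => ->.
have /card_gt0P[v _] := arc_regular_card_gt0 G_arc_regular.
exists 'C_G[v | 'P]%g; split; first exact: subsetIl.
  exact: stab_intersecting.
exact: (card_arc_regular_stab X_simple X_cubic G_arc_regular).
Qed.
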